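(* If $\sigma$ is an unrestrictive permutation then $F_n(123,\sigma)=F_n(123)$ for all $n\ge 0$. In particular, $|F_n(123,\sigma)|=2^{n-1}$ for all $n\ge 1$.
   Context: A permutation contains a pattern $\sigma$ if some subsequence of it has the same length and relative order as $\sigma$; otherwise it avoids $\sigma$. A copy of the Fishburn pattern $f$ in a permutation $\pi$ (in one-line notation) is a subsequence $\pi_j,\pi_{j+1},\pi_k$ with $j+1<k$, $\pi_j=\pi_k+1$, and $\pi_{j+1}>\pi_j$; a Fishburn permutation is one with no copy of $f$. $F_n(\sigma_1,\dots,\sigma_m)$ is the set of Fishburn permutations of length $n$ avoiding each $\sigma_i$. A permutation $\sigma$ is unrestrictive if $\sigma$ avoids $123$, $\sigma$ contains $f$, and $\sigma$ contains at least one of $2413$ and $3412$. *)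

(* Defs.v *)
From mathcomp Require Import all_boot all_fingroup.

Set Implicit Arguments.
Unset Strict Implicit.
Unset Printing Implicit Defensive.

(* One-line notation, with values in {1, ..., n}; positions are 0-based. *)
Definition oneline (n : nat) (p : 'S_n) : seq nat :=
  [seq (p i).+1 | i <- enum 'I_n].

Definition order_iso (s t : seq nat) : bool :=
  (size s == size t) &&
  [forall i : 'I_(size s), forall j : 'I_(size s),
     (nth 0 s i < nth 0 s j) == (nth 0 t i < nth 0 t j)].

(* [mask m w], for m a bit vector of length [size w], ranges over the
   subsequences of w. *)
Definition contains (w s : seq nat) : bool :=
  [exists m : (size w).-tuple bool, order_iso (mask m w) s].

Definition avoids (w s : seq nat) : bool := ~~ contains w s.

Definition contains_fishburn (w : seq nat) : bool :=
  [exists j : 'I_(size w), exists k : 'I_(size w),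
     [&& j.+1 < k, nth 0 w j == (nth 0 w k).+1 & nth 0 w j < nth 0 w j.+1]].

Definition fishburn_perm (n : nat) (p : 'S_n) : bool :=
  ~~ contains_fishburn (oneline p).

Definition fishburn_avoiders (n : nat) (pats : seq (seq nat)) : {set 'S_n} :=
  [set p : 'S_n | fishburn_perm p & all (avoids (oneline p)) pats].

Definition unrestrictive (k : nat) (sigma : 'S_k) : bool :=
  [&& avoids (oneline sigma) [:: 1; 2; 3],
      contains_fishburn (oneline sigma)
    & contains (oneline sigma) [:: 2; 4; 1; 3]
      || contains (oneline sigma) [:: 3; 4; 1; 2]].

(* Main.v *)
Require Import Defs.
From mathcomp Require Import all_boot all_fingroup.
From mathcomp Require Import zify.

(** In a Fishburn permutation avoiding 123, every ascent has bottom 1: if [x y]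
  is an ascent with [x > 1], then the entry [x - 1] either precedes [x], giving
  the 123-pattern [x-1, x, y], or follows [y], giving the copy [x, y, x-1] of
  the Fishburn pattern. So these permutations are exactly the concatenations of
  a decreasing word ending in 1 and a decreasing word; a subset of [{2, ..., n}]
  tells which entries come before the 1, whence the count. Such a word cannot
  have two ascending pairs one after the other, as 2413 and 3412 do. *)

(** * Pattern containment by increasing maps of positions *)

Lemma gtn_trans : transitive gtn.
Proof. by move=> y x z /= yx zy; apply: ltn_trans zy yx. Qed.

Lemma order_isoP (s t : seq nat) :
  reflect (size s = size t /\
           {in gtn (size s) &, forall i j,
             (nth 0 s i < nth 0 s j) = (nth 0 t i < nth 0 t j)})
          (order_iso s t).
Proof.
apply: (iffP andP) => [[/eqP st /forallP H]|[st H]]; split=> //.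
- by move=> i j lti ltj; move/forallP/(_ (Ordinal ltj))/eqP: (H (Ordinal lti)).
- exact/eqP.
- by apply/forallP=> i; apply/forallP=> j; apply/eqP/H; rewrite inE /= ltn_ord.
Qed.

(** Maps of positions compose with order arguments more easily than masks. A mask yields the list of
    positions that it keeps; conversely, the values of [f] below [size s] form a subsequence of all
    positions, hence come from a mask. Values of [f] beyond [size s] are arbitrary. *)
Lemma containsP (w s : seq nat) :
  reflect (exists f : nat -> nat,
             [/\ {in gtn (size s) &, {homo f : i j / i < j}},
                 forall i, i < size s -> f i < size w
               & {in gtn (size s) &, forall i j,
                   (nth 0 w (f i) < nth 0 w (f j)) = (nth 0 s i < nth 0 s j)}])
          (contains w s).
Proof.
apply: (iffP existsP) => [[m /order_isoP[ms H]]|[f [fmono fw fs]]].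
- pose P := mask m (iota 0 (size w)).
  have maskE : mask m w = map (nth 0 w) P.
    by rewrite map_mask map_nth_iota0 // take_size.
  have sP : size P = size s by rewrite -ms maskE size_map.
  have Psort : sorted ltn P by exact: (sorted_mask ltn_trans _ (iota_ltn_sorted _ _)).
  exists (nth 0 P); split.
  + by rewrite -sP; apply: sorted_ltn_nth ltn_trans _ _ Psort.
  + move=> i lti; have : nth 0 P i \in iota 0 (size w).
      by apply: (@mem_mask _ _ m); rewrite mem_nth // sP.
    by rewrite mem_iota.
  + move=> i j lti ltj; rewrite -H ?ms //.
    by rewrite maskE !(nth_map 0) ?sP.
- have Psub : subseq (mkseq f (size s)) (iota 0 (size w)).
    (* Both lists are strictly increasing with the same elements, and a filtered list is visibly a
       subsequence. *)
    have -> : mkseq f (size s) = filter (mem (mkseq f (size s))) (iota 0 (size w)).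
      apply: (irr_sorted_eq ltn_trans ltnn).
      + apply/(sortedP 0) => i; rewrite size_mkseq => lti.
        by rewrite !nth_mkseq //; [apply: fmono; rewrite ?inE; lia | lia].
      + exact: (sorted_filter ltn_trans _ (iota_ltn_sorted _ _)).
      + move=> x; rewrite mem_filter mem_iota /=.
        case: (boolP (x \in _)) => //= /mapP[i].
        by rewrite mem_iota add0n => /= lti ->; rewrite fw.
    exact: filter_subseq.
  case/subseqP: Psub => m; rewrite size_iota => /eqP sm mE.
  exists (Tuple sm); rewrite /=.
  have -> : mask m w = map (nth 0 w) (mkseq f (size s)).
    by rewrite mE map_mask map_nth_iota0 // take_size.
  have sE : size (map (nth 0 w) (mkseq f (size s))) = size s.
    by rewrite size_map size_mkseq.
  apply/order_isoP; split=> // i j; rewrite !inE sE => lti ltj.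
  by rewrite !(nth_map 0 0 (nth 0 w)) ?size_mkseq // !nth_mkseq // fs.
Qed.

Lemma contains_123 (w : seq nat) (i j k : nat) :
  i < j -> j < k -> k < size w ->
  nth 0 w i < nth 0 w j -> nth 0 w j < nth 0 w k ->
  contains w [:: 1; 2; 3].
Proof.
move=> ij jk kw wij wjk; apply/containsP; exists (nth 0 [:: i; j; k]); split.
- by move=> [|[|[|a]]] [|[|[|b]]] //= _ _ _; lia.
- by move=> [|[|[|a]]] //= _; lia.
- by move=> [|[|[|a]]] [|[|[|b]]] //= _ _; lia.
Qed.

(** * Words made of two decreasing runs *)

Section TwoDecreasingRuns.

Variables u v : seq nat.
Hypotheses (usort : sorted gtn u) (vsort : sorted gtn v).

(** Values fall inside each run, so a rising pair has one entry in each. *)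
Lemma rise_straddles (i j : nat) :
  i < j -> j < size (u ++ v) -> nth 0 (u ++ v) i < nth 0 (u ++ v) j ->
  i < size u <= j.
Proof.
rewrite size_cat !nth_cat => ij ltj.
case: (ltnP i) => iu; case: (ltnP j) => //= ju; [|by lia|].
- by have /= := sorted_ltn_nth gtn_trans 0 usort i j iu ju ij; lia.
- have iv : i - size u \in gtn (size v) by rewrite inE /=; lia.
  have jv : j - size u \in gtn (size v) by rewrite inE /=; lia.
  have ijv : i - size u < j - size u by lia.
  by have /= := sorted_ltn_nth gtn_trans 0 vsort _ _ iv jv ijv; lia.
Qed.

(** In an occurrence both rises straddle the boundary between the runs: [f j] lies beyond it and
    [f k] before it, against [f j <= f k]. Allowing [j = k] makes the lemma cover 123. *)
Lemma avoids_consecutive_rises (s : seq nat) (i j k l : nat) :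
  i < j -> j <= k -> k < l -> l < size s ->
  nth 0 s i < nth 0 s j -> nth 0 s k < nth 0 s l ->
  avoids (u ++ v) s.
Proof.
move=> ij jk kl ls sij skl; apply/containsP => -[f [fmono fw fs]].
have [ks js] : k < size s /\ j < size s by lia.
have is_ : i < size s by lia.
have fij := fmono i j is_ js ij; have fkl := fmono k l ks ls kl.
have fjk : f j <= f k.
  by move: jk; rewrite leq_eqVlt => /predU1P[-> //|jk]; apply/ltnW/fmono.
have := rise_straddles _ _ fij (fw j js); rewrite fs // => /(_ sij).
have := rise_straddles _ _ fkl (fw l ls); rewrite fs // => /(_ skl).
by lia.
Qed.

End TwoDecreasingRuns.

(** * The shape of Fishburn permutations avoiding 123 *)

Lemma size_perm_iota (w : seq nat) (n : nat) :
  perm_eq w (iota 1 n) -> size w = n.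
Proof. by move/perm_size; rewrite size_iota. Qed.

Lemma fishburn_ascent_bottom (n : nat) (w : seq nat) (i : nat) :
  perm_eq w (iota 1 n) -> ~~ contains_fishburn w -> avoids w [:: 1; 2; 3] ->
  i.+1 < size w -> nth 0 w i < nth 0 w i.+1 -> nth 0 w i = 1.
Proof.
move=> wP nf n123 ltS asc.
have lti : i < size w by lia.
have memw (x : nat) : (x \in w) = (0 < x <= n).
  by rewrite (perm_mem wP) mem_iota; lia.
have := memw (nth 0 w i); rewrite mem_nth // => /esym/andP[wi0 win].
apply/eqP; apply/contraT => wi1.
have vw : (nth 0 w i).-1 \in w by rewrite memw; lia.
have [l lw wl] : exists2 l, l < size w & nth 0 w l = (nth 0 w i).-1.
  by exists (index (nth 0 w i).-1 w); rewrite ?index_mem ?nth_index.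
have il : i != l by apply/eqP => il; rewrite -il in wl; lia.
have iSl : i.+1 != l by apply/eqP => il'; rewrite -il' in wl; lia.
case: (ltnP l i) => li.
  case/negP: n123; apply: (contains_123 w l i i.+1) => //; lia.
case/negP: nf; apply/existsP; exists (Ordinal lti).
apply/existsP; exists (Ordinal lw) => /=; rewrite wl asc andbT.
by apply/andP; split; [|apply/eqP]; lia.
Qed.

(** The word is cut just after its entry 1, which exists since [0 < n]; by [fishburn_ascent_bottom]
    no ascent starts anywhere else. *)
Lemma fishburn_avoids_123P (n : nat) (w : seq nat) :
  0 < n -> perm_eq w (iota 1 n) ->
  reflect (exists u v, [/\ w = rcons u 1 ++ v, sorted gtn (rcons u 1)
                         & sorted gtn v])
          (~~ contains_fishburn w && avoids w [:: 1; 2; 3]).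
Proof.
move=> n0 wP; have uw : uniq w by rewrite (perm_uniq wP) iota_uniq.
have memw (x : nat) : (x \in w) = (0 < x <= n).
  by rewrite (perm_mem wP) mem_iota; lia.
apply: (iffP andP) => [[nf n123]|[u [v [wE u1s vs]]]].
- have w1 : 1 \in w by rewrite memw.
  have desc i : i != index 1 w -> i.+1 < size w -> nth 0 w i.+1 < nth 0 w i.
    move=> i1 ltS; case: (ltngtP (nth 0 w i) (nth 0 w i.+1)) => //.
    + move/(fishburn_ascent_bottom n w i wP nf n123 ltS) => wi.
      by move: i1; rewrite -{1}wi index_uniq ?(ltnW ltS) // eqxx.
    + by move/eqP; rewrite nth_uniq ?(ltnW ltS) // => /eqP; lia.
  have lw : index 1 w < size w by rewrite index_mem.
  exists (take (index 1 w) w), (drop (index 1 w).+1 w); split.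
  + by rewrite -{2}(nth_index 0 w1) -take_nth // cat_take_drop.
  + rewrite -{2}(nth_index 0 w1) -take_nth //.
    apply/(sortedP 0) => i; rewrite size_takel // ltnS => lti /=.
    by rewrite !nth_take ?desc //; lia.
  + apply/(sortedP 0) => i; rewrite size_drop => lti /=.
    by rewrite !nth_drop addnS desc //; lia.
- split; last first.
    (* The pattern 123 is two rises sharing their middle entry. *)
    by rewrite wE; apply: (avoids_consecutive_rises _ _ u1s vs _ 0 1 1 2).
  apply/existsP => -[[j _] /existsP[[k kw] /= /and3P[jk /eqP wj asc]]].
  have wk : 0 < nth 0 w k by have := mem_nth 0 kw; rewrite memw => /andP[].
  have jw : j.+1 < size w by lia.
  have := rise_straddles _ _ u1s vs j j.+1 (ltnSn j).
  rewrite -wE => /(_ jw asc); rewrite size_rcons => ju.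
  (* The ascent straddles the cut, so it starts at the entry 1; the last entry of a Fishburn copy
     would then be 0. *)
  have {}ju : j = size u by lia.
  move: wk; rewrite -ltnS -wj {1}wE ju nth_cat size_rcons ltnSn nth_rcons.
  by rewrite ltnn eqxx.
Qed.

(** * One-line notation as a bijection onto the rearrangements of 1, ..., n *)

Lemma size_oneline (n : nat) (p : 'S_n) : size (oneline p) = n.
Proof. by rewrite size_map -cardE card_ord. Qed.

Lemma nth_oneline (n : nat) (p : 'S_n) (i : 'I_n) :
  nth 0 (oneline p) i = (p i).+1.
Proof.
by rewrite (nth_map i) ?nth_ord_enum // -cardE card_ord.
Qed.

Lemma oneline_inj (n : nat) : injective (@oneline n).
Proof.
move=> p q pq; apply/permP => i; apply/val_inj/succn_inj.
by rewrite -!nth_oneline pq.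
Qed.

Lemma perm_oneline (n : nat) (p : 'S_n) : perm_eq (oneline p) (iota 1 n).
Proof.
have us : uniq (oneline p).
  by rewrite map_inj_uniq ?enum_uniq // => i j [/val_inj/perm_inj].
apply: uniq_perm (iota_uniq _ _) _ => //.
apply: (uniq_min_size us _ _).2; last by rewrite size_oneline size_iota.
by move=> x /mapP[i _ ->]; rewrite mem_iota /= add1n ltnS ltn_ord.
Qed.

Lemma oneline_surj (n : nat) (w : seq nat) :
  perm_eq w (iota 1 n) -> exists p : 'S_n, oneline p = w.
Proof.
move=> wP; have sw := size_perm_iota _ _ wP.
have uw : uniq w by rewrite (perm_uniq wP) iota_uniq.
have wi (i : 'I_n) : 0 < nth 0 w i <= n.
  have : nth 0 w i \in iota 1 n by rewrite -(perm_mem wP) mem_nth ?sw.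
  by rewrite mem_iota; lia.
have lt (i : 'I_n) : (nth 0 w i).-1 < n by have := wi i; lia.
have inj : injective (fun i => Ordinal (lt i)).
  move=> i j [] eij; case/andP: (wi i) (wi j) => i0 _ /andP[j0 _].
  apply/val_inj/eqP; rewrite -(nth_uniq 0 _ _ uw) ?sw ?ltn_ord //.
  by rewrite -(prednK i0) eij prednK.
exists (perm inj); apply: (@eq_from_nth _ 0); rewrite size_oneline ?sw // => i ltn.
by rewrite (nth_oneline _ _ (Ordinal ltn)) permE /= prednK //; case/andP: (wi (Ordinal ltn)).
Qed.

(** * Encoding by subsets, and the count *)

(* The index [i : 'I_m] encodes the entry [i + 2] of a permutation of
   [{1, ..., m + 1}]; the entry 1 has no index. *)
Definition decreasing_word (m : nat) (A : {set 'I_m}) : seq nat :=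
  rev [seq i.+2 | i : 'I_m in A].

Definition valley_word (m : nat) (A : {set 'I_m}) : seq nat :=
  rcons (decreasing_word m A) 1 ++ decreasing_word m (~: A).

Lemma image_ord_iota (m : nat) : [seq i.+2 | i : 'I_m] = iota 2 m.
Proof. by rewrite /image_mem (map_comp (addn 2) val) val_enum_ord -iotaDl. Qed.

Lemma decreasing_word_sorted (m : nat) (A : {set 'I_m}) :
  sorted gtn (decreasing_word m A).
Proof.
rewrite rev_sorted; apply: subseq_sorted (iota_ltn_sorted 2 m).
  by move=> y x z; apply: ltn_trans.
by rewrite -image_ord_iota; apply/map_subseq; rewrite !enumT filter_subseq.
Qed.

Lemma mem_decreasing_word (m : nat) (A : {set 'I_m}) (i : 'I_m) :
  (i.+2 \in decreasing_word m A) = (i \in A).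
Proof.
rewrite mem_rev; apply/imageP/idP => [[j jA [/val_inj ->]]|iA] //.
by exists i.
Qed.

(** A strictly decreasing word is determined by its set of letters. *)
Lemma decreasing_wordE (m : nat) (A : {set 'I_m}) (s : seq nat) :
  sorted gtn s -> {subset s <= iota 2 m} ->
  (forall i : 'I_m, (i.+2 \in s) = (i \in A)) -> s = decreasing_word m A.
Proof.
move=> ss sm sA; apply: (irr_sorted_eq gtn_trans (fun x => ltnn x)) => //.
  exact: decreasing_word_sorted.
move=> x; apply/idP/idP => [xs|].
- have := sm x xs; rewrite mem_iota => xm.
  have xm' : x - 2 < m by lia.
  have xE : x = (Ordinal xm').+2 by rewrite /=; lia.
  by move: xs; rewrite xE sA mem_decreasing_word.
- by rewrite mem_rev => /imageP[i iA ->]; rewrite sA.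
Qed.

Lemma one_notin_decreasing_word (m : nat) (A : {set 'I_m}) :
  1 \notin decreasing_word m A.
Proof. by rewrite mem_rev; apply/imageP => -[]. Qed.

Lemma rcons_decreasing_word_sorted (m : nat) (A : {set 'I_m}) :
  sorted gtn (rcons (decreasing_word m A) 1).
Proof.
rewrite (sorted_pairwise gtn_trans) pairwise_rcons -(sorted_pairwise gtn_trans).
rewrite decreasing_word_sorted andbT; apply/allP => x.
by rewrite mem_rev => /imageP[i _ ->].
Qed.

(** The letters standing before the 1 recover the subset. *)
Lemma valley_word_inj (m : nat) : injective (valley_word m).
Proof.
move=> A B AB; suff dAB : decreasing_word m A = decreasing_word m B.
  by apply/setP => i; rewrite -!mem_decreasing_word dAB.
have takeE C : take (index 1 (valley_word m C)) (valley_word m C) = decreasing_word m C.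
  rewrite /valley_word -cats1 -catA index_cat.
  by rewrite (negPf (one_notin_decreasing_word _ _)) /= addn0 take_size_cat.
by rewrite -takeE AB takeE.
Qed.

(** Once the 1 is moved to the front, the remaining letters come from [A] and its complement, which
    together give each index once. *)
Lemma perm_valley_word (m : nat) (A : {set 'I_m}) :
  perm_eq (valley_word m A) (iota 1 m.+1).
Proof.
rewrite /valley_word -cats1 -catA perm_catCA /= perm_cons.
rewrite /decreasing_word -rev_cat perm_rev -map_cat.
rewrite -image_ord_iota; apply/perm_map/uniq_perm; rewrite ?enum_uniq //.
  rewrite cat_uniq !enum_uniq andbT /=; apply/hasPn => i.
  by rewrite !mem_enum inE negbK.
by move=> i; rewrite mem_cat !mem_enum !inE orNb.
Qed.

Lemma fishburn_avoiders_123P (m : nat) (p : 'S_m.+1) :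
  reflect (exists A : {set 'I_m}, oneline p = valley_word m A)
          (p \in fishburn_avoiders m.+1 [:: [:: 1; 2; 3]]).
Proof.
have pP := perm_oneline _ p.
rewrite inE /= andbT /fishburn_perm.
apply: (iffP (fishburn_avoids_123P _ _ (ltn0Sn m) pP)) => [|[A ->]]; last first.
  exists (decreasing_word m A), (decreasing_word m (~: A)); split=> //.
    exact: rcons_decreasing_word_sorted.
  exact: decreasing_word_sorted.
case=> u [v [pE u1s vs]]; have us := subseq_sorted gtn_trans (subseq_rcons u 1) u1s.
exists [set i : 'I_m | i.+2 \in u].
(* Cancel the 1 on both sides. *)
have perm_uv : perm_eq (u ++ v) (iota 2 m).
  by rewrite -(perm_cons 1) -[1 :: iota 2 m]/(iota 1 m.+1) -(permPr pP) pE
             -cats1 -catA perm_sym (perm_catCA u [:: 1] v).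
have uuv : uniq (u ++ v) by rewrite (perm_uniq perm_uv) iota_uniq.
have sub_uv x : x \in u ++ v -> x \in iota 2 m by rewrite (perm_mem perm_uv).
rewrite pE /valley_word; congr (rcons _ 1 ++ _); apply: decreasing_wordE => //.
- by move=> x xu; apply: sub_uv; rewrite mem_cat xu.
- by move=> i; rewrite inE.
- by move=> x xv; apply: sub_uv; rewrite mem_cat xv orbT.
- move=> i; rewrite !inE.
  (* Each letter other than 1 lies in exactly one of [u] and [v], so [v] carries the complement. *)
  have : i.+2 \in u ++ v by rewrite (perm_mem perm_uv) mem_iota !ltnS /=.
  move: uuv; rewrite cat_uniq mem_cat => /and3P[_ /hasPn uv _].
  by case: (boolP (_ \in v)) => [/uv /= -> //|_]; rewrite orbF => ->.
Qed.

Lemma card_fishburn_avoiders_123 (m : nat) :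
  #|fishburn_avoiders m.+1 [:: [:: 1; 2; 3]]| = 2 ^ m.
Proof.
have -> : 2 ^ m = #|{set 'I_m}| by rewrite -cardsT -powersetT card_powerset cardsT card_ord.
(* Boolean equality lets [xchoose] pick the permutation of each subset; the set to be counted is the
   image of this injective choice. *)
have wE (A : {set 'I_m}) : exists p : 'S_m.+1, oneline p == valley_word m A.
  by case: (oneline_surj _ _ (perm_valley_word m A)) => p <-; exists p.
rewrite -(card_imset _ (_ : injective (fun A => xchoose (wE A)))); last first.
  move=> A B AB; apply: valley_word_inj.
  by rewrite -(eqP (xchooseP (wE A))) AB (eqP (xchooseP (wE B))).
apply: eq_card => p; apply/fishburn_avoiders_123P/imsetP => [[A pA]|[A _ ->]].
- exists A => //; apply: oneline_inj.
  by rewrite pA (eqP (xchooseP (wE A))).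
- by exists A; rewrite (eqP (xchooseP (wE A))).
Qed.

(** * Patterns with two successive rises impose no further restriction *)

Lemma fishburn_avoiders_consecutive_rises (n : nat) (s : seq nat) (i j k l : nat) :
  i < j -> j <= k -> k < l -> l < size s ->
  nth 0 s i < nth 0 s j -> nth 0 s k < nth 0 s l ->
  fishburn_avoiders n [:: [:: 1; 2; 3]; s] = fishburn_avoiders n [:: [:: 1; 2; 3]].
Proof.
move=> ij jk kl ls sij skl; apply/setP => p; rewrite !inE /= !andbT andbA.
apply: andb_idr => p123; case: n p p123 => [|n] p p123.
  (* Length 0 has no entry 1 to cut at; there the empty word has no position to receive [l]. *)
  by apply/containsP => -[f [_ /(_ l ls)]]; rewrite size_oneline.
have [u [v [-> us vs]]] := fishburn_avoids_123P _ _ (ltn0Sn n) (perm_oneline _ p) p123.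
exact: avoids_consecutive_rises ij jk kl ls sij skl.
Qed.

(** Both 2413 and 3412 rise from their first to their second entry and from their third to their
    fourth; an occurrence carries these rises into [sigma]. *)
Lemma unrestrictive_consecutive_rises (k : nat) (sigma : 'S_k) :
  unrestrictive sigma -> exists a b c d : nat,
    [/\ [/\ a < b, b <= c, c < d & d < k],
        nth 0 (oneline sigma) a < nth 0 (oneline sigma) b
      & nth 0 (oneline sigma) c < nth 0 (oneline sigma) d].
Proof.
case/and3P => _ _ H.
have [s [ss s01 s23 /containsP[f [fmono fw fs]]]] : exists s,
    [/\ size s = 4, nth 0 s 0 < nth 0 s 1, nth 0 s 2 < nth 0 s 3
      & contains (oneline sigma) s].
  by case/orP: H => H; [exists [:: 2; 4; 1; 3]|exists [:: 3; 4; 1; 2]].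
rewrite ss size_oneline in fmono fw fs.
by exists (f 0), (f 1), (f 2), (f 3); rewrite !fs // !fw // !fmono // ltnW ?fmono.
Qed.

Theorem proposition6p5 (k : nat) (sigma : 'S_k) (hsigma : unrestrictive sigma) :
  (forall n : nat,
     fishburn_avoiders n [:: [:: 1; 2; 3]; oneline sigma] =
     fishburn_avoiders n [:: [:: 1; 2; 3]]) /\
  (forall n : nat, 1 <= n ->
     #|fishburn_avoiders n [:: [:: 1; 2; 3]; oneline sigma]| = 2 ^ (n - 1)).
Proof.
have [a [b [c [d [[ab bc cd dk] sab scd]]]]] := unrestrictive_consecutive_rises _ _ hsigma.
have eqF n : fishburn_avoiders n [:: [:: 1; 2; 3]; oneline sigma] =
             fishburn_avoiders n [:: [:: 1; 2; 3]].
  by apply: fishburn_avoiders_consecutive_rises ab bc cd _ sab scd; rewrite size_oneline.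
by split=> // -[//|n] _; rewrite eqF card_fishburn_avoiders_123 subn1.
Qed.
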